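(* If every geodesic on $\Sigma_\Gamma$ intersects the open ball $B(\pi(x),\rho)$ and $\rho<\operatorname{inj}(\Gamma,x)$, then the set of lengths $$\mathcal{L}_{S^+(\ell,\rho,x)}=\{s-t : s,t\in S^+(\ell,\rho,x),\ s>t,\ (t,s)\cap S^+(\ell,\rho,x)=\emptyset\}$$ is countably infinite.
   Context: $\mathbb{D}=\{z\in\mathbb{C}:|z|<1\}$ with hyperbolic metric $d$ induced by $ds=2|dz|/(1-|z|^2)$; geodesics are parametrised with unit speed and the normal bundle of an oriented geodesic is oriented by the standard orientation of $\mathbb{D}$ and that of the geodesic. Standing setting: $\Gamma$ is a cocompact Fuchsian group with fundamental domain $\tau$ a hyperbolic polygon whose side-pairing generators are none of them their own inverse; $\Sigma_\Gamma=\Gamma\backslash\mathbb{D}$ with quotient map $\pi$ and induced metric; $\ell$ is a geodesic in $\mathbb{D}$ with unit-speed parametrisation $\kappa_\ell$ such that the image of $\{(\kappa_\ell(t),\kappa_\ell'(t))\}$ in $\operatorname{ST}(\Sigma_\Gamma)$ is a dense orbit of the geodesic flow; $x\in\tau^\circ$ and $\rho>0$. $\operatorname{inj}(\Gamma,x)=\frac12\inf\{d(y,z):y,z\in\Gamma(x),y\ne z\}$. For a geodesic $k$ with unit-speed parametrisation $\kappa$: $\overline{\mathcal{N}(k,\rho)}^+$ is the union of $\{y:d(y,k)<\rho\}$ with the component of its boundary on the positive side of $k$; $p_k$ is orthogonal projection onto $k$; $S^+(k,\rho,x)=\kappa^{-1}(p_k(\Gamma(x)\cap\overline{\mathcal{N}(k,\rho)}^+))\subseteq\mathbb{R}$.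 *)

(* Defs.v *)
From Stdlib Require Import Reals.
From Coquelicot Require Import Coquelicot.

Open Scope R_scope.

(* ---------- the disc and its hyperbolic metric ds = 2|dz|/(1-|z|^2) ---------- *)
Definition inD (z : C) : Prop := Cmod z < 1.

(* d(z,w) = 2 artanh( |z-w| / |1 - z conj w| ) = ln((1+u)/(1-u)) *)
Definition hdist (z w : C) : R :=
  let u := Cmod (Cminus z w) / Cmod (Cminus (RtoC 1) (Cmult z (Cconj w))) in
  ln ((1 + u) / (1 - u)).

(* ---------- SU(1,1): (a,b) ~ [[a, b],[conj b, conj a]], |a|^2-|b|^2 = 1 ---------- *)
Definition su11 (g : C * C) : Prop :=
  Cmod (fst g) ^ 2 - Cmod (snd g) ^ 2 = 1.
Definition su_one : C * C := (RtoC 1, RtoC 0).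
Definition su_mul (g h : C * C) : C * C :=
  (Cplus (Cmult (fst g) (fst h)) (Cmult (snd g) (Cconj (snd h))),
   Cplus (Cmult (fst g) (snd h)) (Cmult (snd g) (Cconj (fst h)))).
Definition su_inv (g : C * C) : C * C := (Cconj (fst g), Copp (snd g)).

Definition mob (g : C * C) (z : C) : C :=
  Cdiv (Cplus (Cmult (fst g) z) (snd g))
       (Cplus (Cmult (Cconj (snd g)) z) (Cconj (fst g))).

Definition is_subgroup (Gam : C * C -> Prop) : Prop :=
  (forall g, Gam g -> su11 g) /\ Gam su_one /\
  (forall g h, Gam g -> Gam h -> Gam (su_mul g h)) /\
  (forall g, Gam g -> Gam (su_inv g)).

Definition is_discrete (Gam : C * C -> Prop) : Prop :=
  exists eps, 0 < eps /\
    forall g, Gam g -> Cmod (Cminus (fst g) (RtoC 1)) < eps ->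
      Cmod (snd g) < eps -> g = su_one.

Definition is_Fuchsian (Gam : C * C -> Prop) : Prop :=
  is_subgroup Gam /\ is_discrete Gam.

Definition acts_trivially (g : C * C) : Prop := forall z, inD z -> mob g z = z.

(* phi_a : the isometry z |-> (z - a)/(1 - conj a z) sending a to 0 *)
Definition phi (a z : C) : C :=
  Cdiv (Cminus z a) (Cminus (RtoC 1) (Cmult (Cconj a) z)).

(* > 0 : z lies strictly to the left of the oriented geodesic through a then b;
   = 0 : z lies on that geodesic *)
Definition left_of (a b z : C) : R := Im (Cmult (Cconj (phi a b)) (phi a z)).

(* polygon with vertices v 0, ..., v (n-1) in counterclockwise order, v n = v 0 *)
Definition polygon_ok (n : nat) (v : nat -> C) : Prop :=
  (3 <= n)%nat /\ v n = v O /\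
  (forall i, (i < n)%nat -> inD (v i)) /\
  (forall i j, (i < n)%nat -> (j < n)%nat -> v i = v j -> i = j) /\
  (forall i j, (i < n)%nat -> (j < n)%nat -> v j <> v i -> v j <> v (S i) ->
     0 < left_of (v i) (v (S i)) (v j)).

Definition polygon (n : nat) (v : nat -> C) (z : C) : Prop :=
  inD z /\ forall i, (i < n)%nat -> 0 <= left_of (v i) (v (S i)) z.

Definition polygon_int (n : nat) (v : nat -> C) (z : C) : Prop :=
  inD z /\ forall i, (i < n)%nat -> 0 < left_of (v i) (v (S i)) z.

Definition polygon_side (n : nat) (v : nat -> C) (i : nat) (z : C) : Prop :=
  polygon n v z /\ left_of (v i) (v (S i)) z = 0.

Definition is_fundamental_domain (Gam : C * C -> Prop) (n : nat) (v : nat -> C) : Prop :=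
  (forall z, inD z -> exists g, Gam g /\ polygon n v (mob g z)) /\
  (forall g, Gam g -> (exists z, polygon_int n v z /\ polygon_int n v (mob g z)) ->
     acts_trivially g).

Definition side_pairings_not_involutions (Gam : C * C -> Prop) (n : nat) (v : nat -> C) : Prop :=
  forall g i, Gam g -> (i < n)%nat ->
    (forall z, (polygon n v z /\ exists w, polygon n v w /\ z = mob g w)
               <-> polygon_side n v i z) ->
    ~ acts_trivially (su_mul g g).

(* every oriented unit-speed geodesic of D is t |-> M(tanh(t/2)) for some M in SU(1,1) *)
Definition kappa (M : C * C) (t : R) : C := mob M (RtoC (tanh (t / 2))).

(* unit tangent bundle of D: (z, w) with hyperbolic norm of w at z equal to 1 *)
Definition in_ST (z w : C) : Prop := inD z /\ 2 * Cmod w / (1 - Cmod z ^ 2) = 1.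

(* the image of t |-> (kappa t, kappa' t) in ST(Gam\D) is dense: equivalently its
   Gam-saturation { ((g o kappa)(t), (g o kappa)'(t)) } is dense in ST(D) *)
Definition dense_geodesic (Gam : C * C -> Prop) (M : C * C) : Prop :=
  forall p w, in_ST p w -> forall eps, 0 < eps ->
    exists g t (u : C), Gam g /\
      is_derive (fun s => mob g (kappa M s)) t u /\
      Cmod (Cminus (mob g (kappa M t)) p) < eps /\ Cmod (Cminus u w) < eps.

Definition orbit (Gam : C * C -> Prop) (x y : C) : Prop := exists g, Gam g /\ y = mob g x.

Definition inj_rad (Gam : C * C -> Prop) (x : C) : Rbar :=
  Rbar_mult (Finite (/ 2))
    (Glb_Rbar (fun r => exists y z, orbit Gam x y /\ orbit Gam x z /\ y <> z /\ r = hdist y z)).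

Definition geod_dist (M : C * C) (y : C) : Rbar :=
  Glb_Rbar (fun r => exists s, r = hdist y (kappa M s)).

(* y on the positive side of k (left of the oriented geodesic) *)
Definition positive_side (M : C * C) (y : C) : Prop := 0 < Im (mob (su_inv M) y).

(* closure of N(k,rho) restricted to the boundary component on the positive side *)
Definition in_Nplus (M : C * C) (rho : R) (y : C) : Prop :=
  inD y /\ (Rbar_lt (geod_dist M y) (Finite rho) \/
            (geod_dist M y = Finite rho /\ positive_side M y)).

(* p_k(y) = kappa M t : kappa M t is the (unique) nearest point of k to y *)
Definition proj_param (M : C * C) (y : C) (t : R) : Prop :=
  forall s, hdist y (kappa M t) <= hdist y (kappa M s).

Definition Splus (Gam : C * C -> Prop) (M : C * C) (rho : R) (x : C) (t : R) : Prop :=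
  exists y, orbit Gam x y /\ in_Nplus M rho y /\ proj_param M y t.

Definition gap_lengths (S : R -> Prop) (r : R) : Prop :=
  exists s t, S s /\ S t /\ t < s /\ (forall u, t < u < s -> ~ S u) /\ r = s - t.

Definition countably_infinite (A : R -> Prop) : Prop :=
  exists f : nat -> R, (forall m n, f m = f n -> m = n) /\
                       (forall r, A r <-> exists n, f n = r).

(* Main.v *)
Require Import Defs.
From Stdlib Require Import Reals Lra Lia ZArith List ClassicalEpsilon Cantor.
From Coquelicot Require Import Coquelicot.

(* Write d for the hyperbolic distance.  Along any geodesic k, cosh d(y, k(s)) = r cosh (s - t), where k(t)
   is the projection of y on k and r = cosh d(y, k).

   Infinitely many lengths: let I > 2 rho be the infimum of the distances between distinct points of the
   orbit of x, and choose orbit points y, z with D = d(y, z) close to I.  If a geodesic passes close to y and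
   z, no orbit point at distance at most rho from it can project strictly between their projections: by the
   triangle inequality it would be at distance less than I from y or from z.  So the projections of y and z
   bound a gap.  For the geodesics through y in directions close to that of z, the gap length is
   artanh (beta / cosh D), with beta ranging over an interval ending at sinh D.  By density, translates of the
   given geodesic approach each of these, so that every such value is a limit of gap lengths.

   Countability: distinct gaps are disjoint intervals, so each length is determined by a rational number in
   a gap having that length. *)

(** * The disc and its isometries *)

Definition nsq (z : C) : R := fst z ^ 2 + snd z ^ 2.

(** The hyperbolic cosine of [hdist] on the disc. It is rational in the coordinates, which suits
    derivatives and limits better than the logarithm. *)
Definition chd (z w : C) : R :=
  1 + 2 * nsq (Cminus z w) / ((1 - nsq z) * (1 - nsq w)).

Definition mob_den (g : C * C) (z : C) : C :=
  Cplus (Cmult (Cconj (snd g)) z) (Cconj (fst g)).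

Lemma nsq_ge0 z : 0 <= nsq z.
Proof. unfold nsq; nra. Qed.

Lemma Cmod_sq z : Cmod z ^ 2 = nsq z.
Proof. unfold Cmod; rewrite pow2_sqrt; [easy | apply nsq_ge0]. Qed.

Lemma inD_nsq z : inD z <-> nsq z < 1.
Proof.
  unfold inD; rewrite <- Cmod_sq; generalize (Cmod_ge_0 z).
  split; nra.
Qed.

Lemma nsq_eq0 z : nsq z = 0 -> z = RtoC 0.
Proof.
  intros H; apply Cmod_eq_0; generalize (Cmod_ge_0 z); rewrite <- Cmod_sq in H; nra.
Qed.

Lemma nsq_mult z w : nsq (Cmult z w) = nsq z * nsq w.
Proof. unfold nsq, Cmult; simpl; ring. Qed.

Lemma nsq_div z w : w <> RtoC 0 -> nsq (Cdiv z w) = nsq z / nsq w.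
Proof.
  intros Hw; rewrite <- !Cmod_sq, Cmod_div by easy.
  field; now apply Rgt_not_eq, Cmod_gt_0.
Qed.

(** For any pair [(a, b)] the left side is [|a|^2 - |b|^2] times [1 - nsq z]. This keeps the
    denominator away from zero and the image inside the disc. *)
Lemma su11_mob_den g z :
  su11 g -> nsq (mob_den g z) - nsq (Cplus (Cmult (fst g) z) (snd g)) = 1 - nsq z.
Proof.
  unfold su11; rewrite !Cmod_sq; destruct g as [[a1 a2] [b1 b2]], z as [z1 z2].
  unfold mob_den, nsq; simpl; intros H.
  transitivity ((1 - (z1^2+z2^2)) * (a1 * (a1 * 1) + a2 * (a2 * 1) - (b1 * (b1 * 1) + b2 * (b2 * 1)))); [ring|].
  rewrite H; ring.
Qed.

Lemma mob_den_gt0 g z : su11 g -> inD z -> 0 < nsq (mob_den g z).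
Proof.
  intros Hg Hz; apply inD_nsq in Hz.
  generalize (su11_mob_den g z Hg) (nsq_ge0 (Cplus (Cmult (fst g) z) (snd g))); lra.
Qed.

Lemma mob_den_neq0 g z : su11 g -> inD z -> mob_den g z <> RtoC 0.
Proof.
  intros Hg Hz E; generalize (mob_den_gt0 g z Hg Hz); rewrite E; unfold nsq; simpl; lra.
Qed.

Lemma nsq_mob g z :
  su11 g -> inD z -> 1 - nsq (mob g z) = (1 - nsq z) / nsq (mob_den g z).
Proof.
  intros Hg Hz; generalize (mob_den_gt0 g z Hg Hz); intros Hd.
  unfold mob; fold (mob_den g z).
  rewrite nsq_div by now apply mob_den_neq0.
  rewrite <- (su11_mob_den g z Hg); field; lra.
Qed.

Lemma mob_inD g z : su11 g -> inD z -> inD (mob g z).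
Proof.
  intros Hg Hz; apply inD_nsq.
  generalize (nsq_mob g z Hg Hz) (mob_den_gt0 g z Hg Hz); intros E Hd.
  apply inD_nsq in Hz.
  assert (0 < (1 - nsq z) / nsq (mob_den g z)) by (apply Rdiv_lt_0_compat; lra).
  lra.
Qed.

Lemma su11_C g :
  su11 g -> Cminus (Cmult (fst g) (Cconj (fst g))) (Cmult (snd g) (Cconj (snd g))) = RtoC 1.
Proof.
  unfold su11; intros H; rewrite <- !Cmod2_conj, <- H.
  rewrite RtoC_minus; reflexivity.
Qed.

Lemma mob_minus g z w :
  su11 g -> inD z -> inD w ->
  Cminus (mob g z) (mob g w) = Cdiv (Cminus z w) (Cmult (mob_den g z) (mob_den g w)).
Proof.
  intros Hg Hz Hw.
  generalize (mob_den_neq0 g z Hg Hz) (mob_den_neq0 g w Hg Hw); intros Dz Dw.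
  (* With the determinant kept as a factor this is an identity of rational functions; the
     determinant is then replaced by 1. *)
  transitivity (Cdiv (Cmult (Cminus z w) (Cminus (Cmult (fst g) (Cconj (fst g))) (Cmult (snd g) (Cconj (snd g)))))
     (Cmult (mob_den g z) (mob_den g w))).
  - unfold mob; fold (mob_den g z) (mob_den g w).
    unfold mob_den in *; field; split; assumption.
  - rewrite su11_C, Cmult_1_r by easy; reflexivity.
Qed.

Lemma chd_mob g z w :
  su11 g -> inD z -> inD w -> chd (mob g z) (mob g w) = chd z w.
Proof.
  intros Hg Hz Hw; unfold chd.
  generalize (mob_den_neq0 g z Hg Hz) (mob_den_neq0 g w Hg Hw); intros Dz Dw.
  generalize (mob_den_gt0 g z Hg Hz) (mob_den_gt0 g w Hg Hw); intros Pz Pw.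
  rewrite mob_minus, nsq_div, nsq_mult, !nsq_mob by (try apply Cmult_neq_0; easy).
  apply inD_nsq in Hz; apply inD_nsq in Hw.
  field; repeat split; lra.
Qed.

Lemma su11_mul g h : su11 g -> su11 h -> su11 (su_mul g h).
Proof.
  unfold su11; rewrite !Cmod_sq; destruct g as [[a1 a2] [b1 b2]], h as [[c1 c2] [d1 d2]].
  unfold nsq; simpl; intros H K.
  transitivity ((a1 * (a1 * 1) + a2 * (a2 * 1) - (b1 * (b1 * 1) + b2 * (b2 * 1)))
     * (c1 * (c1 * 1) + c2 * (c2 * 1) - (d1 * (d1 * 1) + d2 * (d2 * 1)))); [ring|].
  rewrite H, K; ring.
Qed.

Lemma su11_inv g : su11 g -> su11 (su_inv g).
Proof.
  unfold su11, su_inv; simpl; rewrite Cmod_conj, Cmod_opp; easy.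
Qed.

Lemma mob_mul g h z :
  su11 g -> su11 h -> inD z -> mob (su_mul g h) z = mob g (mob h z).
Proof.
  intros Hg Hh Hz.
  assert (D1 := mob_den_neq0 h z Hh Hz).
  assert (D2 := mob_den_neq0 g _ Hg (mob_inD h z Hh Hz)).
  assert (D3 := mob_den_neq0 _ z (su11_mul g h Hg Hh) Hz).
  unfold mob, mob_den, su_mul in *; simpl in *.
  rewrite !Cplus_conj, !Cmult_conj, !Cconj_conj in *.
  field; repeat split; try assumption.
  intros E; apply D3; rewrite <- E; ring.
Qed.

Lemma mob_one z : mob su_one z = z.
Proof.
  unfold mob, su_one; simpl.
  replace (Cconj (RtoC 0)) with (RtoC 0) by (unfold Cconj, RtoC; simpl; f_equal; ring).
  replace (Cconj (RtoC 1)) with (RtoC 1) by (unfold Cconj, RtoC; simpl; f_equal; ring).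
  field.
Qed.

Lemma su_inv_inv g : su_inv (su_inv g) = g.
Proof.
  destruct g as [a b]; unfold su_inv; simpl; rewrite Cconj_conj; f_equal; ring.
Qed.

Lemma mob_invl g z : su11 g -> inD z -> mob (su_inv g) (mob g z) = z.
Proof.
  intros Hg Hz; rewrite <- mob_mul; [|now apply su11_inv|easy|easy].
  replace (su_mul (su_inv g) g) with su_one; [apply mob_one|].
  unfold su_mul, su_inv, su_one; simpl; rewrite <- (su11_C g Hg); f_equal; ring.
Qed.

Lemma mob_invr g z : su11 g -> inD z -> mob g (mob (su_inv g) z) = z.
Proof.
  intros Hg Hz; rewrite <- (su_inv_inv g) at 1; apply mob_invl; [now apply su11_inv|easy].
Qed.

Lemma chd_mob_inv g z w :
  su11 g -> inD z -> inD w -> chd z (mob g w) = chd (mob (su_inv g) z) w.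
Proof.
  intros Hg Hz Hw; rewrite <- (mob_invr g z Hg Hz) at 1.
  apply chd_mob; try easy; apply mob_inD; [now apply su11_inv|easy].
Qed.

Lemma chd_ge1 z w : inD z -> inD w -> 1 <= chd z w.
Proof.
  rewrite !inD_nsq; intros Hz Hw; unfold chd.
  assert (0 <= 2 * nsq (Cminus z w) / ((1 - nsq z) * (1 - nsq w))); [|lra].
  apply Rmult_le_pos; [generalize (nsq_ge0 (Cminus z w)); lra|].
  apply Rlt_le, Rinv_0_lt_compat; nra.
Qed.

(** The pseudo-hyperbolic distance: on the disc, the hyperbolic tangent of half of [hdist]. *)
Definition hratio (z w : C) : R :=
  Cmod (Cminus z w) / Cmod (Cminus (RtoC 1) (Cmult z (Cconj w))).

(** In the disc the last product is positive, whence [hratio < 1]; the same identity converts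
    [hratio] into [chd]. *)
Lemma nsq_den_eq z w :
  nsq (Cminus (RtoC 1) (Cmult z (Cconj w))) = nsq (Cminus z w) + (1 - nsq z) * (1 - nsq w).
Proof. unfold nsq; simpl; ring. Qed.

Lemma hratio_bounds z w : inD z -> inD w ->
  0 <= hratio z w < 1 /\ chd z w = (1 + hratio z w ^ 2) / (1 - hratio z w ^ 2).
Proof.
  intros Hz Hw; apply inD_nsq in Hz; apply inD_nsq in Hw.
  assert (P : 0 < (1 - nsq z) * (1 - nsq w)) by nra.
  assert (E := nsq_den_eq z w).
  assert (N := nsq_ge0 (Cminus z w)).
  assert (D : 0 < Cmod (Cminus (RtoC 1) (Cmult z (Cconj w)))).
  { generalize (Cmod_ge_0 (Cminus (RtoC 1) (Cmult z (Cconj w)))).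
    rewrite <- Cmod_sq in E. nra. }
  assert (Q : hratio z w ^ 2 = nsq (Cminus z w) / (nsq (Cminus z w) + (1 - nsq z) * (1 - nsq w))).
  { unfold hratio. rewrite <- E, <- !Cmod_sq. field; lra. }
  assert (G : 0 <= hratio z w).
  { unfold hratio; apply Rdiv_le_0_compat; [apply Cmod_ge_0|easy]. }
  assert (L : hratio z w ^ 2 < 1).
  { rewrite Q. apply Rlt_div_l; lra. }
  repeat split; [easy|nra|].
  rewrite Q; unfold chd; field; repeat split; lra.
Qed.

Lemma hdist_hratio z w : hdist z w = ln ((1 + hratio z w) / (1 - hratio z w)).
Proof. reflexivity. Qed.

Lemma hdist_ge0 z w : inD z -> inD w -> 0 <= hdist z w.
Proof.
  intros Hz Hw; destruct (hratio_bounds z w Hz Hw) as [[G L] _].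
  rewrite hdist_hratio, <- ln_1; apply ln_le; [lra|].
  apply Rle_div_r; lra.
Qed.

Lemma cosh_hdist z w : inD z -> inD w -> cosh (hdist z w) = chd z w.
Proof.
  intros Hz Hw; destruct (hratio_bounds z w Hz Hw) as [[G L] ->].
  rewrite hdist_hratio; unfold cosh; rewrite exp_Ropp, exp_ln.
  - field; repeat split; nra.
  - apply Rdiv_lt_0_compat; lra.
Qed.

Lemma cosh_opp x : cosh (- x) = cosh x.
Proof. unfold cosh; rewrite Ropp_involutive; field. Qed.

Lemma cosh_sq x : cosh x ^ 2 = 1 + sinh x ^ 2.
Proof.
  unfold cosh, sinh; rewrite exp_Ropp; field; apply Rgt_not_eq, exp_pos.
Qed.

Lemma cosh_ge1 x : 1 <= cosh x.
Proof.
  assert (0 < cosh x) by (unfold cosh; generalize (exp_pos x) (exp_pos (-x)); lra).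
  generalize (cosh_sq x); nra.
Qed.

Lemma cosh_plus x y : cosh (x + y) = cosh x * cosh y + sinh x * sinh y.
Proof.
  unfold cosh, sinh; rewrite Ropp_plus_distr, !exp_plus; field.
Qed.

Lemma cosh_minus x y : cosh (x - y) = cosh x * cosh y - sinh x * sinh y.
Proof.
  unfold cosh, sinh; rewrite Ropp_minus_distr; unfold Rminus.
  rewrite !exp_plus; field.
Qed.

Lemma cosh_lt x y : 0 <= x -> x < y -> cosh x < cosh y.
Proof.
  intros Hx Hy.
  assert (E : cosh y - cosh x = 2 * sinh ((y + x) / 2) * sinh ((y - x) / 2)).
  { transitivity (cosh ((y + x) / 2 + (y - x) / 2) - cosh ((y + x) / 2 - (y - x) / 2));
      [f_equal; f_equal; field|rewrite cosh_plus, cosh_minus; ring]. }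
  assert (0 < sinh ((y + x) / 2)) by (rewrite <- sinh_0; apply sinh_lt; lra).
  assert (0 < sinh ((y - x) / 2)) by (rewrite <- sinh_0; apply sinh_lt; lra).
  nra.
Qed.

Lemma cosh_le x y : 0 <= x -> x <= y -> cosh x <= cosh y.
Proof. intros Hx [H | ->]; [left; now apply cosh_lt | right; reflexivity]. Qed.

Lemma cosh_lt_inv x y : 0 <= y -> cosh x < cosh y -> x < y.
Proof.
  intros Hy H; apply Rnot_le_lt; intros L; generalize (cosh_le y x Hy L); lra.
Qed.

Lemma cosh_le_inv x y : 0 <= y -> cosh x <= cosh y -> x <= y.
Proof.
  intros Hy H; apply Rnot_lt_le; intros L; generalize (cosh_lt y x Hy L); lra.
Qed.

Lemma cosh_eq1 x : cosh x = 1 -> x = 0.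
Proof.
  intros H; destruct (Rtotal_order x 0) as [L | [E | L]]; [|easy|].
  - generalize (cosh_lt 0 (- x)); rewrite cosh_opp, cosh_0; lra.
  - generalize (cosh_lt 0 x); rewrite cosh_0; lra.
Qed.

Lemma hdist_mob g z w :
  su11 g -> inD z -> inD w -> hdist (mob g z) (mob g w) = hdist z w.
Proof.
  intros Hg Hz Hw.
  assert (E : cosh (hdist (mob g z) (mob g w)) = cosh (hdist z w)).
  { rewrite !cosh_hdist by (try apply mob_inD; easy); now apply chd_mob. }
  apply Rle_antisym; apply cosh_le_inv; try (apply hdist_ge0; try apply mob_inD; easy); lra.
Qed.

Lemma hdist_sym z w : hdist z w = hdist w z.
Proof.
  unfold hdist.
  replace (Cmod (Cminus z w)) with (Cmod (Cminus w z)).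
  - replace (Cmod (Cminus 1 (Cmult z (Cconj w)))) with (Cmod (Cminus 1 (Cmult w (Cconj z)))); [easy|].
    rewrite <- (Cmod_conj (Cminus 1 (Cmult z (Cconj w)))).
    f_equal; rewrite Cminus_conj, Cmult_conj, Cconj_conj.
    unfold Cconj, RtoC, Cminus, Cmult, Cplus, Copp; simpl; f_equal; ring.
  - rewrite <- Cmod_opp; f_equal; ring.
Qed.

(** The translation [z |-> (z + b) / (1 + conj b z)], scaled to determinant 1. It serves to move
    computations to the centre of the disc. *)
Definition su_to (b : C) : C * C :=
  (RtoC (/ sqrt (1 - nsq b)), Cmult (RtoC (/ sqrt (1 - nsq b))) b).

Lemma su_to_spec b : inD b -> su11 (su_to b) /\ mob (su_to b) (RtoC 0) = b.
Proof.
  intros Hb; apply inD_nsq in Hb.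
  assert (S : 0 < sqrt (1 - nsq b)) by (apply sqrt_lt_R0; lra).
  assert (S2 : sqrt (1 - nsq b) * sqrt (1 - nsq b) = 1 - nsq b) by (apply sqrt_sqrt; lra).
  assert (N : RtoC (sqrt (1 - nsq b)) <> RtoC 0) by (intros E; injection E; lra).
  split.
  - unfold su11, su_to; simpl fst; simpl snd; rewrite !Cmod_sq, nsq_mult.
    replace (nsq (RtoC (/ sqrt (1 - nsq b)))) with (/ (1 - nsq b)).
    + field; lra.
    + rewrite <- S2 at 1; generalize dependent (sqrt (1 - nsq b)); intros q Hq _ _.
      unfold nsq; simpl; field; lra.
  - unfold mob, su_to; simpl fst; simpl snd.
    replace (Cconj (RtoC (/ sqrt (1 - nsq b)))) with (RtoC (/ sqrt (1 - nsq b)))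
      by (unfold Cconj, RtoC; simpl; f_equal; ring).
    rewrite RtoC_inv by lra.
    field; easy.
Qed.

Lemma inD_0 : inD (RtoC 0).
Proof. apply inD_nsq; unfold nsq; simpl; lra. Qed.

Lemma ln_hratio_le u v : 0 <= u -> u <= v -> v < 1 ->
  ln ((1 + u) / (1 - u)) <= ln ((1 + v) / (1 - v)).
Proof.
  intros; apply ln_le; [apply Rdiv_lt_0_compat; lra|].
  apply Rle_div_l; [lra|].
  replace ((1 + v) / (1 - v) * (1 - u)) with ((1 + v) * (1 - u) / (1 - v)) by (field; lra).
  apply Rle_div_r; nra.
Qed.

(** From the centre, [hratio] is the modulus. By the addition formula for tanh the claim becomes
    [hratio a c <= (r + s) / (1 + r s)], with [r] and [s] the moduli of [a] and [c]; both sides are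
    then squared. *)
Lemma hdist_triangle_0 a c : inD a -> inD c ->
  hdist a c <= hdist a (RtoC 0) + hdist (RtoC 0) c.
Proof.
  intros Ha Hc.
  assert (R0 : forall z, hratio z (RtoC 0) = Cmod z).
  { intros z; unfold hratio.
    replace (Cminus z (RtoC 0)) with z by ring.
    replace (Cminus (RtoC 1) (Cmult z (Cconj (RtoC 0)))) with (RtoC 1)
      by (unfold Cconj, RtoC, Cminus, Cmult, Cplus, Copp; simpl; f_equal; ring).
    rewrite Cmod_1; field. }
  rewrite (hdist_sym (RtoC 0) c), !hdist_hratio, !R0.
  destruct (hratio_bounds a c Ha Hc) as [[G L] _].
  assert (A0 := Cmod_ge_0 a); assert (C0 := Cmod_ge_0 c).
  assert (A2 := Cmod_sq a); assert (C2 := Cmod_sq c).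
  unfold inD in Ha, Hc.
  set (r := Cmod a) in *; set (s := Cmod c) in *.
  rewrite <- ln_mult by (apply Rdiv_lt_0_compat; lra).
  replace ((1 + r) / (1 - r) * ((1 + s) / (1 - s)))
    with ((1 + (r + s) / (1 + r * s)) / (1 - (r + s) / (1 + r * s))).
  2: { field; repeat split; try nra. }
  assert (P : 0 < 1 + r * s) by nra.
  assert (U : (r + s) / (1 + r * s) < 1) by (apply Rlt_div_l; nra).
  apply ln_hratio_le; try easy.
  unfold hratio in *.
  set (dn := Cmod (Cminus 1 (Cmult a (Cconj c)))) in *.
  assert (D0 : 0 < dn).
  { apply Rnot_le_lt; intros Hd. assert (E := nsq_den_eq a c).
    rewrite <- Cmod_sq in E; fold dn in E.
    assert (0 <= dn) by apply Cmod_ge_0.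
    assert (0 <= nsq (Cminus a c)) by apply nsq_ge0.
    assert (0 < (1 - nsq a) * (1 - nsq c)) by (rewrite <- A2, <- C2; apply Rmult_lt_0_compat; nra).
    replace dn with 0 in E by lra. lra. }
  apply Rle_div_l; [easy|].
  replace ((r + s) / (1 + r * s) * dn) with ((r + s) * dn / (1 + r * s)) by (field; lra).
  apply Rle_div_r; [easy|].
  apply Rsqr_incr_0_var; [|unfold dn; apply Rmult_le_pos; [lra|apply Cmod_ge_0]].
  unfold Rsqr.
  assert (E1 := Cmod_sq (Cminus a c)); assert (E2 := nsq_den_eq a c).
  rewrite <- Cmod_sq in E2; fold dn in E2.
  set (m := Cmod (Cminus a c)) in *.
  (* with [Q = Re (a conj c) >= - r s], the difference of the two sides is [2 (Q + r s) (1 - r^2) (1 - s^2)] *)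
  set (Q := fst a * fst c + snd a * snd c).
  assert (M2 : nsq (Cminus a c) = r ^ 2 + s ^ 2 - 2 * Q).
  { rewrite A2, C2; unfold Q, nsq; simpl; ring. }
  assert (HQ : 0 <= Q + r * s).
  { assert (Q ^ 2 <= (r * s) ^ 2).
    { replace ((r * s) ^ 2) with (r ^ 2 * s ^ 2) by ring; rewrite A2, C2.
      unfold Q, nsq; generalize (pow2_ge_0 (fst a * snd c - snd a * fst c)); nra. }
    assert (0 <= r * s) by nra. nra. }
  assert (K : 0 <= (Q + r * s) * ((1 - r ^ 2) * (1 - s ^ 2))).
  { apply Rmult_le_pos; [easy|]; apply Rmult_le_pos; nra. }
  replace (m * (1 + r * s) * (m * (1 + r * s))) with (m ^ 2 * (1 + r * s) ^ 2) by ring.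
  replace ((r + s) * dn * ((r + s) * dn)) with ((r + s) ^ 2 * dn ^ 2) by ring.
  rewrite E2, E1, M2, <- A2, <- C2.
  lra.
Qed.

(** An isometry moves the middle point to the centre. *)
Lemma hdist_triangle a b c : inD a -> inD b -> inD c ->
  hdist a c <= hdist a b + hdist b c.
Proof.
  intros Ha Hb Hc; destruct (su_to_spec b Hb) as [S E].
  assert (S' := su11_inv _ S).
  assert (Ka : inD (mob (su_inv (su_to b)) a)) by now apply mob_inD.
  assert (Kc : inD (mob (su_inv (su_to b)) c)) by now apply mob_inD.
  assert (Ea := mob_invr _ a S Ha); assert (Ec := mob_invr _ c S Hc).
  revert Ka Kc Ea Ec.
  generalize (mob (su_inv (su_to b)) a) (mob (su_inv (su_to b)) c); intros a' c' Ka Kc <- <-.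
  clear S'; revert S E; generalize (su_to b); intros N S <-.
  rewrite !hdist_mob by (try apply inD_0; easy).
  now apply hdist_triangle_0.
Qed.

(** * Distance to a geodesic *)

Lemma chd_diag p : chd p p = 1.
Proof. unfold chd, nsq; simpl; rewrite !Rplus_opp_r; unfold Rdiv; ring. Qed.

Lemma inD_tanh t : inD (RtoC (tanh t)).
Proof.
  apply inD_nsq; unfold nsq, tanh; simpl.
  assert (E := cosh_sq t); assert (C1 := cosh_ge1 t).
  replace (sinh t / cosh t * (sinh t / cosh t * 1) + 0 * (0 * 1))
    with (sinh t ^ 2 / cosh t ^ 2) by (field; lra).
  apply Rlt_div_l; nra.
Qed.

Lemma kappa_inD N t : su11 N -> inD (kappa N t).
Proof. intros HN; apply mob_inD; [easy | apply inD_tanh]. Qed.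

(** In the hyperboloid model the point [tanh (s / 2)] is [(cosh s, sinh s, 0)], and the right side
    is its Lorentz product with the vector of [z]. *)
Lemma chd_tanh z s : inD z ->
  chd z (RtoC (tanh (s / 2)))
  = ((1 + nsq z) * cosh s - 2 * fst z * sinh s) / (1 - nsq z).
Proof.
  intros Hz; apply inD_nsq in Hz.
  assert (Cs : cosh s = cosh (s / 2) ^ 2 + sinh (s / 2) ^ 2)
    by (replace s with (s / 2 + s / 2) at 1 by field; rewrite cosh_plus; ring).
  assert (Ss : sinh s = 2 * sinh (s / 2) * cosh (s / 2)).
  { unfold sinh, cosh; replace s with (s / 2 + s / 2) at 1 2 by field.
    rewrite Ropp_plus_distr, !exp_plus; field. }
  rewrite Cs, Ss; clear Cs Ss; unfold tanh.
  assert (E := cosh_sq (s / 2)); assert (C1 := cosh_ge1 (s / 2)).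
  set (c := cosh (s / 2)) in *; set (h := sinh (s / 2)) in *.
  unfold chd.
  replace (nsq (RtoC (h / c))) with (h ^ 2 / c ^ 2) by (unfold nsq; simpl; field; lra).
  replace (nsq (Cminus z (RtoC (h / c)))) with (nsq z - 2 * fst z * h / c + h ^ 2 / c ^ 2)
    by (unfold nsq; simpl; field; lra).
  replace (1 - h ^ 2 / c ^ 2) with (1 / c ^ 2) by (replace (h ^ 2) with (c ^ 2 - 1) by lra; field; lra).
  replace (1 + nsq z) with ((1 - nsq z) + 2 * nsq z) by ring.
  transitivity (((1 - nsq z) + 2 * (nsq z * c ^ 2 - 2 * fst z * h * c + h ^ 2)) / (1 - nsq z)).
  - field; lra.
  - f_equal. replace (c ^ 2) with (1 + h ^ 2) by lra. ring.
Qed.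

(* In the hyperboloid model [cosh d(y, k(s))] is [T cosh s - X sinh s] with [T^2 - X^2 >= 1];
   [ts] is the parameter of the orthogonal projection of [y] and [cosh] of the distance to [k] is [r]. *)
Lemma chd_kappa N y : su11 N -> inD y ->
  exists r ts, 1 <= r /\ forall s, chd y (kappa N s) = r * cosh (s - ts).
Proof.
  intros HN Hy.
  assert (Hz : inD (mob (su_inv N) y)) by (apply mob_inD; [now apply su11_inv|easy]).
  assert (E : forall s, chd y (kappa N s) = chd (mob (su_inv N) y) (RtoC (tanh (s / 2))))
    by (intros s; apply chd_mob_inv; [easy|easy|apply inD_tanh]).
  generalize dependent (mob (su_inv N) y); intros z Hz E.
  assert (Hz' := Hz); apply inD_nsq in Hz'.
  set (T := (1 + nsq z) / (1 - nsq z)); set (X := 2 * fst z / (1 - nsq z)).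
  (* Up to the factor [1 - nsq z] in the denominator, [T + X] and [T - X] are the squared Euclidean
     distances from [z] to [-1] and to [1]. *)
  assert (P : 0 < T + X).
  { unfold T, X; replace ((1 + nsq z) / (1 - nsq z) + 2 * fst z / (1 - nsq z))
      with ((1 + nsq z + 2 * fst z) / (1 - nsq z)) by (field; lra).
    apply Rdiv_lt_0_compat; [|lra]; revert Hz'; unfold nsq.
    generalize (pow2_ge_0 (fst z + 1)) (pow2_ge_0 (snd z)); intros.
    assert (fst z <> - 1) by (intros e; rewrite e in *; nra).
    assert (0 < (fst z + 1) ^ 2) by (apply pow2_gt_0; lra). nra. }
  assert (Q : 0 < T - X).
  { unfold T, X; replace ((1 + nsq z) / (1 - nsq z) - 2 * fst z / (1 - nsq z))
      with ((1 + nsq z - 2 * fst z) / (1 - nsq z)) by (field; lra).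
    apply Rdiv_lt_0_compat; [|lra]; revert Hz'; unfold nsq.
    generalize (pow2_ge_0 (fst z - 1)) (pow2_ge_0 (snd z)); intros.
    assert (fst z <> 1) by (intros e; rewrite e in *; nra).
    assert (0 < (fst z - 1) ^ 2) by (apply pow2_gt_0; lra). nra. }
  (* In the null coordinates [T + X = r e^ts] and [T - X = r e^(-ts)], [r] is the geometric mean and
     [ts] half the logarithm of the quotient. *)
  set (r := exp ((ln (T + X) + ln (T - X)) / 2)).
  set (ts := (ln (T + X) - ln (T - X)) / 2).
  assert (Ep : T + X = r * exp ts).
  { unfold r, ts; rewrite <- exp_plus, <- (exp_ln (T + X)) at 1 by easy; f_equal; field. }
  assert (Em : T - X = r * exp (- ts)).
  { unfold r, ts; rewrite <- exp_plus, <- (exp_ln (T - X)) at 1 by easy; f_equal; field. }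
  assert (F : forall s, chd y (kappa N s) = r * cosh (s - ts)).
  { intros s; rewrite E, chd_tanh by easy.
    transitivity (T * cosh s - X * sinh s); [unfold T, X; field; lra|].
    replace T with (r * cosh ts) by (unfold cosh; lra).
    replace X with (r * sinh ts) by (unfold sinh; lra).
    rewrite cosh_minus; ring. }
  exists r, ts; split; [|exact F].
  (* At the foot of the perpendicular the function takes the value [r], which is therefore the cosh
     of a distance. *)
  replace r with (chd y (kappa N ts)).
  - apply chd_ge1; [easy | now apply kappa_inD].
  - rewrite F, Rminus_diag, cosh_0; ring.
Qed.

Lemma hdist_kappa N s t : su11 N -> hdist (kappa N s) (kappa N t) = Rabs (s - t).
Proof.
  intros HN.
  assert (E : cosh (hdist (kappa N s) (kappa N t)) = cosh (s - t)).
  { rewrite cosh_hdist by now apply kappa_inD.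
    unfold kappa; rewrite chd_mob by (try apply inD_tanh; easy).
    assert (I := inD_tanh (s / 2)); apply inD_nsq in I.
    (* Applied to the point itself, at distance 0, the formula relates [tanh (s / 2)] to [cosh s]
       and [sinh s] and so replaces half-angle identities. *)
    assert (E1 := chd_tanh (RtoC (tanh (s / 2))) s (inD_tanh _)).
    rewrite chd_diag in E1.
    rewrite chd_tanh by apply inD_tanh.
    assert (Hc := cosh_sq s). assert (C1 := cosh_ge1 s).
    rewrite cosh_minus.
    set (q := nsq (RtoC (tanh (s / 2)))) in *; set (f := fst (RtoC (tanh (s / 2)))) in *.
    assert (Q : q = f ^ 2) by (unfold q, f, nsq; simpl; ring).
    assert (E2 : (1 + q) * cosh s - 2 * f * sinh s = 1 - q).
    { transitivity ((1 - q) * (((1 + q) * cosh s - 2 * f * sinh s) / (1 - q))); [field; lra|].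
      rewrite <- E1; field; lra. }
    (* [f = tanh (s/2)], so [f (1 + cosh s) = sinh s] *)
    assert (E3 : f * (1 + cosh s) = sinh s).
    { assert ((f * (1 + cosh s) - sinh s) ^ 2 = 0); [|nra].
      transitivity ((1 + cosh s) * ((1 + f ^ 2) * cosh s - 2 * f * sinh s - (1 - f ^ 2))
        - (cosh s ^ 2 - 1 - sinh s ^ 2)); [ring|].
      rewrite <- Q, E2, Hc; ring. }
    assert (T1 : (1 + q) = (1 - q) * cosh s).
    { rewrite Q; apply Rmult_eq_reg_r with ((1 + cosh s) ^ 2); [|nra].
      transitivity ((1 + cosh s) ^ 2 + (f * (1 + cosh s)) ^ 2); [ring|].
      transitivity (((1 + cosh s) ^ 2 - (f * (1 + cosh s)) ^ 2) * cosh s); [|ring].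
      rewrite E3; replace (sinh s ^ 2) with (cosh s ^ 2 - 1) by lra; ring. }
    assert (T2 : 2 * f = (1 - q) * sinh s).
    { rewrite <- E3; transitivity (f * ((1 - q) + (1 - q) * cosh s)); [rewrite <- T1; ring|ring]. }
    rewrite T1, T2; field; lra. }
  assert (E' : cosh (hdist (kappa N s) (kappa N t)) = cosh (Rabs (s - t))).
  { rewrite E; unfold Rabs; destruct (Rcase_abs (s - t)); [now rewrite cosh_opp | easy]. }
  apply Rle_antisym; apply cosh_le_inv; try apply Rabs_pos;
    try (apply hdist_ge0; now apply kappa_inD); lra.
Qed.

(** Since every geodesic passes within [rho] of the orbit, this one will force the orbit of [x] to
    contain a second point. *)
Lemma far_geodesic x rho : inD x -> 0 < rho ->
  exists N, su11 N /\ forall s, rho <= hdist x (kappa N s).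
Proof.
  intros Hx Hr; destruct (su_to_spec x Hx) as [S E].
  set (c := cosh (rho / 2)); set (h := sinh (rho / 2)).
  assert (Hc : c ^ 2 = 1 + h ^ 2) by apply cosh_sq.
  assert (C1 : 1 <= c) by apply cosh_ge1.
  (* The translation by [rho] along the imaginary diameter. It takes the real diameter to a geodesic
     at distance [rho] from the centre, and [su_to x] then takes the centre to [x]. *)
  assert (SB : su11 (RtoC c, (0, h))).
  { unfold su11; simpl fst; simpl snd; rewrite !Cmod_sq; unfold nsq; simpl fst; simpl snd; lra. }
  exists (su_mul (su_to x) (RtoC c, (0, h))).
  split; [now apply su11_mul|]; intros s.
  assert (SM : su11 (su_mul (su_to x) (RtoC c, (0, h)))) by now apply su11_mul.
  apply cosh_le_inv; [apply hdist_ge0; [easy|now apply kappa_inD]|].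
  rewrite cosh_hdist by (try apply kappa_inD; easy).
  unfold kappa; rewrite mob_mul by (try apply inD_tanh; easy).
  rewrite <- E at 1; rewrite chd_mob by (try apply mob_inD; try apply inD_tanh; try apply inD_0; easy).
  rewrite chd_mob_inv by (try apply inD_tanh; try apply inD_0; easy).
  assert (ID : inD (mob (su_inv (RtoC c, (0, h))) (RtoC 0)))
    by (apply mob_inD; [now apply su11_inv | apply inD_0]).
  rewrite chd_tanh by easy.
  replace (mob (su_inv (RtoC c, (0, h))) (RtoC 0)) with (0, - h / c).
  2:{ unfold mob, su_inv, Cdiv, Cinv, Cplus, Cmult, Cconj, Copp, RtoC; simpl; f_equal; field; lra. }
  replace (nsq (0, - h / c)) with (h ^ 2 / c ^ 2) by (unfold nsq; simpl; field; lra).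
  simpl fst.
  replace (((1 + h ^ 2 / c ^ 2) * cosh s - 2 * 0 * sinh s) / (1 - h ^ 2 / c ^ 2))
    with ((c ^ 2 + h ^ 2) * cosh s).
  2:{ replace (1 - h ^ 2 / c ^ 2) with (1 / c ^ 2)
        by (replace (h ^ 2) with (c ^ 2 - 1) by lra; field; lra).
      field; lra. }
  replace rho with (rho / 2 + rho / 2) by field; rewrite cosh_plus; fold c h.
  generalize (cosh_ge1 s); nra.
Qed.

(** * Derivative of the distance along a curve *)

Definition dotC (z w : C) : R := fst z * fst w + snd z * snd w.

(* [slope z p u] is minus the derivative of [chd z] at [p] in the direction [u]. *)
Definition slope (z p u : C) : R :=
  4 * (dotC (Cminus z p) u * (1 - nsq p) - nsq (Cminus z p) * dotC p u)
  / ((1 - nsq z) * (1 - nsq p) ^ 2).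

Lemma is_derive_fst (f : R -> C) t (u : C) :
  is_derive f t u -> is_derive (fun s => fst (f s)) t (fst u).
Proof.
  intros H.
  apply (filterdiff_comp' f (fun z : C => fst z) t (fun y => scal y u) (fun z => fst z) H).
  apply filterdiff_linear, is_linear_fst.
Qed.

Lemma is_derive_snd (f : R -> C) t (u : C) :
  is_derive f t u -> is_derive (fun s => snd (f s)) t (snd u).
Proof.
  intros H.
  apply (filterdiff_comp' f (fun z : C => snd z) t (fun y => scal y u) (fun z => snd z) H).
  apply filterdiff_linear, is_linear_snd.
Qed.

Lemma is_derive_chd (f : R -> C) t (u z : C) :
  inD z -> inD (f t) -> is_derive f t u ->
  is_derive (fun s => chd z (f s)) t (- slope z (f t) u).
Proof.
  intros Hz Hf H; apply inD_nsq in Hz; apply inD_nsq in Hf.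
  assert (H1 := is_derive_fst f t u H); assert (H2 := is_derive_snd f t u H).
  unfold slope, chd, nsq, dotC in *; simpl in *.
  set (a := fun s => fst (f s)) in *; set (b := fun s => snd (f s)) in *.
  change (is_derive (fun s : R => 1 + 2 * ((fst z + - a s) ^ 2 + (snd z + - b s) ^ 2)
    / ((1 - (fst z ^ 2 + snd z ^ 2)) * (1 - (a s ^ 2 + b s ^ 2)))) t
    (- (4 * (((fst z + - a t) * fst u + (snd z + - b t) * snd u) * (1 - (a t ^ 2 + b t ^ 2))
      - ((fst z + - a t) ^ 2 + (snd z + - b t) ^ 2) * (a t * fst u + b t * snd u))
     / ((1 - (fst z ^ 2 + snd z ^ 2)) * (1 - (a t ^ 2 + b t ^ 2)) ^ 2)))).
  auto_derive.
  - repeat split; try (eexists; eassumption).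
    apply Rmult_integral_contrapositive; unfold a, b; split; lra.
  - replace (Derive (fun x => a x) t) with (fst u) by (symmetry; apply is_derive_unique, H1).
    replace (Derive (fun x => b x) t) with (snd u) by (symmetry; apply is_derive_unique, H2).
    assert (1 - (a t ^ 2 + b t ^ 2) <> 0) by (unfold a, b; lra).
    field; split; lra.
Qed.

(** [slope z p] is linear, and its maximum over unit tangent vectors is [sinh d(z, p)], whose square
    is [chd z p ^ 2 - 1]. Turning the vector away from the direction of [z] gives every smaller
    value. *)
Lemma slope_surjective z p beta : inD z -> inD p -> z <> p ->
  beta ^ 2 <= chd z p ^ 2 - 1 -> exists w, in_ST p w /\ slope z p w = beta.
Proof.
  intros Hz Hp Hne Hb.
  assert (Hz' := Hz); assert (Hp' := Hp); apply inD_nsq in Hz'; apply inD_nsq in Hp'.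
  set (m := 1 - nsq p); set (k := 1 - nsq z).
  assert (Pm : 0 < m) by (unfold m; lra); assert (Pk : 0 < k) by (unfold k; lra).
  set (n := nsq (Cminus z p)).
  assert (Pn : 0 < n).
  { destruct (nsq_ge0 (Cminus z p)) as [L | E]; [easy|].
    exfalso; apply Hne; symmetry in E; apply nsq_eq0 in E.
    replace z with (Cplus (Cminus z p) p) by ring; rewrite E; ring. }
  (* [slope z p u] is the scalar product of [u] with [(V1, V2)], multiplied by [4 / (k m^2)]. *)
  set (V1 := m * (fst z - fst p) - n * fst p); set (V2 := m * (snd z - snd p) - n * snd p).
  assert (EV : V1 ^ 2 + V2 ^ 2 = n * (m * k + n)).
  { unfold V1, V2, n, m, k, nsq; simpl; ring. }
  assert (Pn' : 0 < n * (m * k + n)) by (apply Rmult_lt_0_compat; nra).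
  set (v := sqrt (n * (m * k + n))).
  assert (Pv : 0 < v) by (apply sqrt_lt_R0; easy).
  assert (Ev : v ^ 2 = n * (m * k + n)) by (apply pow2_sqrt; lra).
  assert (Ec : chd z p ^ 2 - 1 = 4 * v ^ 2 / (k * m) ^ 2).
  { rewrite Ev; unfold chd; fold n k m; field; lra. }
  (* The cosine of the angle from [(V1, V2)] at which the slope is [beta]. *)
  set (c := beta * (k * m) / (2 * v)).
  assert (Hc : c ^ 2 <= 1).
  { unfold c; replace ((beta * (k * m) / (2 * v)) ^ 2)
      with (beta ^ 2 * ((k * m) ^ 2 / (4 * v ^ 2))) by (field; lra).
    replace 1 with (4 * v ^ 2 / (k * m) ^ 2 * ((k * m) ^ 2 / (4 * v ^ 2))) by (field; repeat split; lra).
    apply Rmult_le_compat_r; [|lra].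
    apply Rlt_le, Rdiv_lt_0_compat; [apply pow_lt|assert (0 < v ^ 2) by (apply pow_lt; easy); lra].
    now apply Rmult_lt_0_compat. }
  set (s := sqrt (1 - c ^ 2)).
  assert (Es : s ^ 2 = 1 - c ^ 2) by (apply pow2_sqrt; lra).
  (* [(V1, V2)] rotated by that angle and scaled to Euclidean length [m / 2], which is hyperbolic
     length 1 at [p]. *)
  exists (m / (2 * v) * (c * V1 - s * V2), m / (2 * v) * (c * V2 + s * V1)).
  split.
  - split; [easy|].
    rewrite Cmod_sq; fold m.
    replace (Cmod _) with (m / 2); [field; lra|].
    unfold Cmod; simpl fst; simpl snd; symmetry.
    replace ((m / (2 * v) * (c * V1 - s * V2)) ^ 2 + (m / (2 * v) * (c * V2 + s * V1)) ^ 2)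
      with ((m / (2 * v)) ^ 2 * ((c ^ 2 + s ^ 2) * (V1 ^ 2 + V2 ^ 2))) by ring.
    rewrite Es, EV, <- Ev.
    replace ((m / (2 * v)) ^ 2 * ((c ^ 2 + (1 - c ^ 2)) * v ^ 2)) with ((m / 2) ^ 2) by (field; lra).
    apply sqrt_pow2; lra.
  - unfold slope; fold n k m.
    transitivity (4 * (m / (2 * v) * (c * (V1 ^ 2 + V2 ^ 2))) / (k * m ^ 2)).
    + f_equal; f_equal; unfold dotC, V1, V2; simpl; ring.
    + rewrite EV, <- Ev; unfold c; field; lra.
Qed.

Lemma slope_diag p u : slope p p u = 0.
Proof.
  unfold slope, dotC, nsq; simpl. rewrite !Rplus_opp_r. unfold Rdiv; ring.
Qed.

(** The function [r cosh (s - ts)] is determined by its value [a] and derivative [-b] at [t]: these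
    are [r cosh (t - ts)] and [r sinh (t - ts)], so [r^2 = a^2 - b^2] and
    [e^(2 (ts - t)) = (a + b) / (a - b)]. The isometry [g] is undone on [q] to return to the fixed
    geodesic. *)
Lemma foot_param g M t (u q : C) :
  su11 g -> su11 M -> inD q -> is_derive (fun s => mob g (kappa M s)) t u ->
  let a := chd q (mob g (kappa M t)) in
  let b := slope q (mob g (kappa M t)) u in
  exists r, 1 <= r /\ r ^ 2 = a ^ 2 - b ^ 2 /\
    forall s, cosh (hdist (mob (su_inv g) q) (kappa M s))
              = r * cosh (s - (t + ln ((a + b) / (a - b)) / 2)).
Proof.
  intros Hg HM Hq Hd a b.
  assert (Hgi := su11_inv g Hg).
  assert (Hq' : inD (mob (su_inv g) q)) by now apply mob_inD.
  destruct (chd_kappa M _ HM Hq') as (r & ts & Hr & F).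
  assert (K : forall s, chd q (mob g (kappa M s)) = r * cosh (s - ts)).
  { intros s; rewrite chd_mob_inv by (try apply kappa_inD; easy); apply F. }
  assert (Ea : a = r * cosh (t - ts)) by apply K.
  assert (Eb : - b = r * sinh (t - ts)).
  { assert (D1 : is_derive (fun s => chd q (mob g (kappa M s))) t (- b))
      by (apply (is_derive_chd (fun s => mob g (kappa M s)));
          [easy|apply mob_inD; [easy|now apply kappa_inD]|easy]).
    apply is_derive_unique in D1; rewrite <- D1.
    rewrite (Derive_ext _ _ _ K).
    apply is_derive_unique; unfold cosh, sinh; auto_derive; [easy|unfold Rminus; field]. }
  exists r; split; [easy|]; split.
  - replace b with (- (r * sinh (t - ts))) by lra; rewrite Ea.
    replace ((r * cosh (t - ts)) ^ 2) with (r ^ 2 * cosh (t - ts) ^ 2) by ring.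
    rewrite cosh_sq; ring.
  - intros s; rewrite cosh_hdist by (try apply kappa_inD; easy); rewrite F.
    f_equal; f_equal.
    replace ((a + b) / (a - b)) with (exp (2 * (ts - t))).
    + rewrite ln_exp; field.
    + replace b with (- (r * sinh (t - ts))) by lra; rewrite Ea; unfold cosh, sinh.
      rewrite exp_Ropp. replace (2 * (ts - t)) with (- (t - ts) + - (t - ts)) by ring.
      rewrite exp_plus, exp_Ropp.
      assert (P := exp_pos (t - ts)).
      transitivity ((r * / exp (t - ts)) / (r * exp (t - ts))); [field; lra|].
      f_equal; field; lra.
Qed.

(** * Gaps, limits and enumeration *)

Lemma proj_param_iff M y r ts t : su11 M -> inD y -> 1 <= r ->
  (forall s, cosh (hdist y (kappa M s)) = r * cosh (s - ts)) ->
  proj_param M y t <-> t = ts.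
Proof.
  intros HM Hy Hr F.
  assert (P : forall s, 0 <= hdist y (kappa M s))
    by (intros s; apply hdist_ge0; [easy|now apply kappa_inD]).
  assert (F0 := F ts); rewrite Rminus_diag, cosh_0 in F0.
  split.
  - intros H; assert (K := cosh_le _ _ (P t) (H ts)).
    rewrite F0, F in K.
    assert (C1 := cosh_ge1 (t - ts)).
    assert (t - ts = 0) by (apply cosh_eq1; nra). lra.
  - intros -> s; apply cosh_le_inv; [apply P|].
    rewrite F0, F; generalize (cosh_ge1 (s - ts)); nra.
Qed.

Lemma geod_dist_proj M y t :
  proj_param M y t -> geod_dist M y = Finite (hdist y (kappa M t)).
Proof.
  intros H; apply is_glb_Rbar_unique; split.
  - intros r [s ->]; apply H.
  - intros b Hb; apply Hb; now exists t.
Qed.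

(* Two almost nearest orbit points lying close to the geodesic have consecutive projections:
   an orbit point projecting strictly between them would be too close to one of them. *)
Lemma gap_criterion (Gam : C * C -> Prop) M x rho I0 delta y z ry rz ty tz :
  (forall g, Gam g -> su11 g) -> su11 M -> inD x ->
  (forall y z, orbit Gam x y -> orbit Gam x z -> y <> z -> I0 <= hdist y z) ->
  orbit Gam x y -> orbit Gam x z -> 1 <= ry -> 1 <= rz ->
  (forall s, cosh (hdist y (kappa M s)) = ry * cosh (s - ty)) ->
  (forall s, cosh (hdist z (kappa M s)) = rz * cosh (s - tz)) ->
  0 < delta <= rho -> ry < cosh delta -> rz < cosh delta ->
  rho + hdist y z / 2 + 2 * delta <= I0 -> ty < tz ->
  gap_lengths (Splus Gam M rho x) (tz - ty).
Proof.
  intros HG HM Hx Hsep Oy Oz Hry Hrz Fy Fz Hd Dy Dz HI Ht.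
  assert (OD : forall w, orbit Gam x w -> inD w)
    by (intros w (g & Hg & ->); apply mob_inD; auto).
  assert (KD : forall s, inD (kappa M s)) by (intros s; now apply kappa_inD).
  assert (near : forall w r t, 1 <= r -> orbit Gam x w ->
    (forall s, cosh (hdist w (kappa M s)) = r * cosh (s - t)) ->
    r < cosh delta -> hdist w (kappa M t) < delta).
  { intros w r t _ _ F L; apply cosh_lt_inv; [lra|].
    rewrite F, Rminus_diag, cosh_0; lra. }
  assert (Ny := near _ _ _ Hry Oy Fy Dy); assert (Nz := near _ _ _ Hrz Oz Fz Dz).
  assert (inS : forall w r t, 1 <= r -> orbit Gam x w ->
    (forall s, cosh (hdist w (kappa M s)) = r * cosh (s - t)) ->
    hdist w (kappa M t) < delta -> Splus Gam M rho x t).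
  { intros w r t Hr Ow F L.
    assert (Pw : proj_param M w t) by (apply (proj_param_iff M w r t t); auto).
    exists w; repeat split; auto.
    left; rewrite (geod_dist_proj _ _ _ Pw); simpl; lra. }
  (* Hence [rho + (tz - ty) / 2 + delta < I0], which is the bound that [far] contradicts. *)
  assert (Hyz : tz - ty < hdist y z + 2 * delta).
  { assert (E := hdist_kappa M tz ty HM); rewrite Rabs_pos_eq in E by lra.
    rewrite <- E, (hdist_sym (kappa M tz)).
    assert (T1 := hdist_triangle (kappa M ty) y (kappa M tz) (KD _) (OD _ Oy) (KD _)).
    assert (T2 := hdist_triangle y z (kappa M tz) (OD _ Oy) (OD _ Oz) (KD _)).
    rewrite (hdist_sym _ y) in T1. lra. }
  exists tz, ty; repeat split; eauto.
  intros u Hu (w & Ow & (Dw & Nw) & Pw).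
  (* Points of the boundary component are at distance exactly [rho], so this bound is not strict;
     the strictness comes from [delta]. *)
  assert (Hw : hdist w (kappa M u) <= rho).
  { rewrite (geod_dist_proj _ _ _ Pw) in Nw; destruct Nw as [L | [L _]].
    - simpl in L; lra.
    - injection L; lra. }
  assert (far : forall q r t, 1 <= r -> orbit Gam x q ->
    (forall s, cosh (hdist q (kappa M s)) = r * cosh (s - t)) ->
    hdist q (kappa M t) < delta -> u <> t -> Rabs (u - t) <= (tz - ty) / 2 -> False).
  { intros q r t Hr Oq F L Hne Hut.
    assert (Hwq : w <> q)
      by (intros ->; apply Hne; apply (proj_param_iff M q r t u); auto).
    assert (S := Hsep w q Ow Oq Hwq).
    assert (T1 := hdist_triangle w (kappa M u) q (OD _ Ow) (KD _) (OD _ Oq)).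
    assert (T2 := hdist_triangle (kappa M u) (kappa M t) q (KD _) (KD _) (OD _ Oq)).
    rewrite hdist_kappa, (hdist_sym (kappa M t) q) in T2 by easy. lra. }
  (* The nearer end of the gap is at most half its length away. *)
  destruct (Rle_dec (u - ty) ((tz - ty) / 2)).
  - apply (far y ry ty); auto; [lra | rewrite Rabs_pos_eq; lra].
  - apply (far z rz tz); auto; [lra | rewrite Rabs_minus_sym, Rabs_pos_eq; lra].
Qed.

Lemma is_lim_seq_nsq (p : nat -> C) (y : C) :
  is_lim_seq (fun n => fst (p n)) (fst y) -> is_lim_seq (fun n => snd (p n)) (snd y) ->
  is_lim_seq (fun n => nsq (p n)) (nsq y).
Proof.
  intros H1 H2; unfold nsq; simpl.
  repeat (apply is_lim_seq_plus' || apply is_lim_seq_mult' || assumption || apply is_lim_seq_const).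
Qed.

Lemma is_lim_seq_nsq_minus (p : nat -> C) (y q : C) :
  is_lim_seq (fun n => fst (p n)) (fst y) -> is_lim_seq (fun n => snd (p n)) (snd y) ->
  is_lim_seq (fun n => nsq (Cminus q (p n))) (nsq (Cminus q y)).
Proof.
  intros H1 H2; apply (is_lim_seq_nsq (fun n => Cminus q (p n))); simpl;
  apply (is_lim_seq_minus' (fun _ => _)); auto; apply is_lim_seq_const.
Qed.

Lemma is_lim_seq_chd (p : nat -> C) (y q : C) : inD y -> inD q ->
  is_lim_seq (fun n => fst (p n)) (fst y) -> is_lim_seq (fun n => snd (p n)) (snd y) ->
  is_lim_seq (fun n => chd q (p n)) (chd q y).
Proof.
  intros Hy Hq H1 H2; apply inD_nsq in Hy; apply inD_nsq in Hq; unfold chd.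
  apply is_lim_seq_plus'; [apply is_lim_seq_const|].
  apply is_lim_seq_div'.
  - apply is_lim_seq_mult'; [apply is_lim_seq_const | now apply is_lim_seq_nsq_minus].
  - apply is_lim_seq_mult'; [apply is_lim_seq_const|].
    apply is_lim_seq_minus'; [apply is_lim_seq_const | now apply is_lim_seq_nsq].
  - nra.
Qed.

Lemma is_lim_seq_slope (p u : nat -> C) (y w q : C) : inD y -> inD q ->
  is_lim_seq (fun n => fst (p n)) (fst y) -> is_lim_seq (fun n => snd (p n)) (snd y) ->
  is_lim_seq (fun n => fst (u n)) (fst w) -> is_lim_seq (fun n => snd (u n)) (snd w) ->
  is_lim_seq (fun n => slope q (p n) (u n)) (slope q y w).
Proof.
  intros Hy Hq H1 H2 H3 H4; apply inD_nsq in Hy; apply inD_nsq in Hq; unfold slope, dotC.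
  assert (K : is_lim_seq (fun n => 1 - nsq (p n)) (1 - nsq y))
    by (apply is_lim_seq_minus'; [apply is_lim_seq_const | now apply is_lim_seq_nsq]).
  assert (N := is_lim_seq_nsq_minus p y q H1 H2).
  apply is_lim_seq_div'.
  - apply is_lim_seq_mult'; [apply is_lim_seq_const|].
    apply is_lim_seq_minus'; apply is_lim_seq_mult'; try assumption;
    apply is_lim_seq_plus'; apply is_lim_seq_mult'; try assumption;
    apply (is_lim_seq_minus' (fun _ => _)); try assumption; apply is_lim_seq_const.
  - apply is_lim_seq_mult'; [apply is_lim_seq_const|]; simpl.
    repeat (apply is_lim_seq_mult'; [assumption|]); apply is_lim_seq_const.
  - apply Rmult_integral_contrapositive; split; [lra | apply pow_nonzero; lra].
Qed.

Lemma is_lim_seq_half_ln (a b : nat -> R) (a0 b0 : R) :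
  is_lim_seq a a0 -> is_lim_seq b b0 -> - a0 < b0 < a0 ->
  is_lim_seq (fun n => ln ((a n + b n) / (a n - b n)) / 2) (ln ((a0 + b0) / (a0 - b0)) / 2).
Proof.
  intros Ha Hb H; apply is_lim_seq_div'; [|apply is_lim_seq_const|lra].
  apply is_lim_seq_continuous.
  - apply continuity_pt_filterlim, continuous_ln.
    apply Rdiv_lt_0_compat; lra.
  - apply is_lim_seq_div'; [now apply is_lim_seq_plus' | now apply is_lim_seq_minus' | lra].
Qed.

Lemma is_lim_seq_eventually_lt (a : nat -> R) (a0 c : R) :
  is_lim_seq a a0 -> a0 < c -> eventually (fun n => a n < c).
Proof.
  intros H L; apply is_lim_seq_spec in H.
  assert (P : 0 < c - a0) by lra.
  destruct (H (mkposreal _ P)) as [N HN]; exists N; intros n Hn.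
  specialize (HN n Hn); simpl in HN; apply Rabs_def2 in HN; lra.
Qed.

Lemma is_lim_seq_Cminus_small (p : nat -> C) (y : C) :
  (forall n, Cmod (Cminus (p n) y) < / (INR n + 1)) ->
  is_lim_seq (fun n => fst (p n)) (fst y) /\ is_lim_seq (fun n => snd (p n)) (snd y).
Proof.
  intros H.
  assert (K : forall (a : nat -> R) (a0 : R), (forall n, Rabs (a n - a0) < / (INR n + 1)) -> is_lim_seq a a0).
  { intros a a0 Ha; apply is_lim_seq_spec; intros eps.
    destruct (nfloor_ex (/ eps)) as [N [_ HN]]; [apply Rlt_le, Rinv_0_lt_compat, cond_pos|].
    exists N; intros n Hn; apply Rlt_trans with (1 := Ha n).
    apply le_INR in Hn.
    rewrite <- (Rinv_inv eps); apply Rinv_lt_contravar; [|lra].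
    apply Rmult_lt_0_compat; [apply Rinv_0_lt_compat, cond_pos|].
    assert (0 <= INR n) by apply pos_INR; lra. }
  split; apply K; intros n; apply Rle_lt_trans with (2 := H n);
    generalize (Rmax_Cmod (Cminus (p n) y)); simpl; unfold Rminus; intros L.
  - apply Rle_trans with (2 := L), Rmax_l.
  - apply Rle_trans with (2 := L), Rmax_r.
Qed.

(** A length is coded by a fraction lying in some gap of that length. Two gaps that share a fraction
    coincide, since neither contains an end of the other. *)
Lemma gap_code (S : R -> Prop) :
  exists c : R -> nat, forall r r', gap_lengths S r -> gap_lengths S r' -> c r = c r' -> r = r'.
Proof.
  (* The integer [a] is recorded by its positive and negative parts; [b] stands for the denominator
     [b + 1], which is never zero. *)
  set (code := fun (a : Z) (b : nat) => to_nat (to_nat (Z.to_nat a, Z.to_nat (- a)), b)).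
  set (rel := fun r k => exists s t a b, S s /\ S t /\ t < s /\ (forall u, t < u < s -> ~ S u) /\
    r = s - t /\ t < IZR a / (INR b + 1) < s /\ k = code a b).
  assert (ex : forall r, exists k, gap_lengths S r -> rel r k).
  (* Reals that are not gap lengths receive the default code 0. *)
  { intros r; destruct (excluded_middle_informative (gap_lengths S r)) as [H|]; [|now exists O].
    destruct H as (s & t & Hs & Ht & L & G & E).
    (* Then [1 / (b + 1) < s - t], so the first multiple of [1 / (b + 1)] beyond [t] lies before
       [s]; [up] gives its numerator. *)
    destruct (nfloor_ex (/ (s - t))) as [b [_ Hb]]; [apply Rlt_le, Rinv_0_lt_compat; lra|].
    assert (B0 : 0 <= INR b) by apply pos_INR.
    assert (Hb' : 1 < (s - t) * (INR b + 1)).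
    { apply Rmult_lt_reg_l with (/ (s - t)); [apply Rinv_0_lt_compat; lra|].
      rewrite <- Rmult_assoc, Rinv_l, Rmult_1_l, Rmult_1_r by lra; easy. }
    destruct (archimed (t * (INR b + 1))) as [U1 U2].
    exists (code (up (t * (INR b + 1))) b); intros _.
    exists s, t, (up (t * (INR b + 1))), b; repeat split; auto.
    - apply Rlt_div_r; lra.
    - apply Rlt_div_l; lra. }
  exists (fun r => proj1_sig (constructive_indefinite_description _ (ex r))).
  intros r r' Hr Hr'.
  destruct (constructive_indefinite_description _ (ex r)) as [k Hk].
  destruct (constructive_indefinite_description _ (ex r')) as [k' Hk'].
  simpl; intros <-.
  destruct (Hk Hr) as (s & t & a & b & Hs & Ht & L & G & -> & B & ->).
  destruct (Hk' Hr') as (s' & t' & a' & b' & Hs' & Ht' & L' & G' & -> & B' & E).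
  apply to_nat_inj, pair_equal_spec in E; destruct E as [E1 <-].
  apply to_nat_inj, pair_equal_spec in E1; destruct E1 as [E2 E3].
  assert (a' = a) as -> by lia.
  assert (t = t').
  { destruct (Rtotal_order t t') as [K | [K | K]]; auto; exfalso.
    - apply (G t'); auto; lra.
    - apply (G' t); auto; lra. }
  assert (s = s').
  { destruct (Rtotal_order s s') as [K | [K | K]]; auto; exfalso.
    - apply (G' s); auto; lra.
    - apply (G s'); auto; lra. }
  now subst.
Qed.

Lemma least_nat (P : nat -> Prop) :
  (exists n, P n) -> exists n, P n /\ forall m, P m -> (n <= m)%nat.
Proof.
  intros [n Hn]; revert Hn; induction n as [n IH] using (well_founded_induction lt_wf); intros Hn.
  destruct (excluded_middle_informative (exists m, P m /\ (m < n)%nat)) as [(m & Hm & L) | N].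
  - now apply (IH m).
  - exists n; split; [easy|]; intros m Hm; apply Nat.nlt_ge; intros L; apply N; now exists m.
Qed.

(* The elements are enumerated in increasing order of their codes. *)
Lemma countably_infinite_of_code (P : R -> Prop) (c : R -> nat) :
  (forall r r', P r -> P r' -> c r = c r' -> r = r') ->
  (forall l : list R, exists r, P r /\ ~ In r l) ->
  countably_infinite P.
Proof.
  intros Hc Hinf.
  (* Only finitely many elements have a code below [N], so some element always has a code at least
     [N]. *)
  assert (fin : forall N, exists l : list R, forall r, P r -> (c r < N)%nat -> In r l).
  { induction N as [|N [l Hl]]; [exists nil; intros; lia|].
    destruct (excluded_middle_informative (exists r, P r /\ c r = N)) as [(r0 & Pr & E) | No].
    - exists (r0 :: l); intros r Hr L.
      destruct (Nat.eq_dec (c r) N) as [E'|]; [left; apply Hc; auto; congruence | right; apply Hl; auto; lia].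
    - exists l; intros r Hr L; apply Hl; auto.
      destruct (Nat.eq_dec (c r) N); [exfalso; apply No; eauto | lia]. }
  assert (nxt : forall N, exists r, P r /\ (N <= c r)%nat /\
    forall r', P r' -> (N <= c r')%nat -> (c r <= c r')%nat).
  { intros N; destruct (fin N) as [l Hl]; destruct (Hinf l) as (r0 & P0 & N0).
    destruct (least_nat (fun k => exists r, P r /\ (N <= c r)%nat /\ c r = k)) as (k & (r & Pr & Lr & E) & Hk).
    - exists (c r0), r0; repeat split; auto.
      apply Nat.nlt_ge; intros L; apply N0, Hl; auto.
    - exists r; repeat split; auto; intros r' Pr' Lr'; rewrite E; apply Hk; eauto. }
  set (next := fun N => proj1_sig (constructive_indefinite_description _ (nxt N))).
  assert (Hn : forall N, P (next N) /\ (N <= c (next N))%nat /\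
     forall r', P r' -> (N <= c r')%nat -> (c (next N) <= c r')%nat)
    by (intros N; unfold next; destruct (constructive_indefinite_description _ (nxt N)); easy).
  set (f := fix f n := match n with O => next O | S m => next (S (c (f m))) end).
  assert (Pf : forall n, P (f n)) by (intros [|n]; apply Hn).
  assert (step : forall n, (c (f n) < c (f (S n)))%nat) by (intros n; apply (Hn (S (c (f n))))).
  assert (mono : forall m n, (m < n)%nat -> (c (f m) < c (f n))%nat).
  { intros m n L; induction L as [|n L IH]; [apply step | specialize (step n); lia]. }
  exists f; split.
  - intros m n E; destruct (Nat.lt_trichotomy m n) as [L | [L | L]]; auto;
      apply mono in L; rewrite E in L; lia.
  - intros r; split; [|intros [n <-]; apply Pf]; intros Pr.
    assert (id_le : forall n, (n <= c (f n))%nat)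
      by (induction n as [|n IH]; [lia | specialize (step n); lia]).
    (* Either [r] has been reached, or the codes up to stage [n] are below that of [r]. At stage
       [c r] the second case contradicts [id_le]. *)
    assert (key : forall n, (exists m, f m = r) \/ (c (f n) < c r)%nat).
    { induction n as [|n [IH | IH]]; [|now left|].
      - destruct (Hn O) as (_ & _ & L); specialize (L r Pr (Nat.le_0_l _)).
        destruct (Nat.eq_dec (c (next O)) (c r)) as [E|];
          [left; exists O; apply Hc; auto; apply Hn|right; simpl; lia].
      - destruct (Hn (S (c (f n)))) as (Q & _ & L); specialize (L r Pr IH).
        destruct (Nat.eq_dec (c (next (S (c (f n))))) (c r)) as [E|];
          [left; exists (S n); apply Hc; auto|right; simpl; lia]. }
    destruct (key (c r)) as [K|K]; [easy | specialize (id_le (c r)); lia].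
Qed.

Lemma interval_avoid_list (l : list R) : forall a b, a < b -> exists x, a < x < b /\ ~ In x l.
Proof.
  (* The induction carries a whole subinterval avoiding the list; for each new element, a half that
     does not contain it in its interior is kept. *)
  assert (K : forall a b, a < b -> exists a' b', a <= a' /\ a' < b' /\ b' <= b /\
     forall x, a' < x < b' -> ~ In x l).
  { induction l as [|h l IH]; intros a b Hab; [exists a, b; repeat split; auto; lra|].
    destruct (IH a b Hab) as (a' & b' & A1 & A2 & A3 & A4).
    destruct (Rle_dec h ((a' + b') / 2)).
    - exists ((a' + b') / 2), b'; repeat split; try lra.
      intros x Hx [E | E]; [lra | apply (A4 x); auto; lra].
    - exists a', ((a' + b') / 2); repeat split; try lra.
      intros x Hx [E | E]; [lra | apply (A4 x); auto; lra]. }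
  intros a b Hab; destruct (K a b Hab) as (a' & b' & A1 & A2 & A3 & A4).
  exists ((a' + b') / 2); split; [lra | apply A4; lra].
Qed.

(** A sequence that converges to a point outside a finite list eventually leaves the list, so limits
    of gap lengths suffice to prove infinitude. *)
Lemma list_separated (l : list R) r : ~ In r l ->
  exists e, 0 < e /\ forall r', In r' l -> e <= Rabs (r' - r).
Proof.
  induction l as [|h l IH]; intros H; [exists 1; split; [lra | easy]|].
  destruct IH as (e & He & K); [intros I; apply H; now right|].
  assert (0 < Rabs (h - r)) by (apply Rabs_pos_lt; intros E; apply H; left; lra).
  exists (Rmin e (Rabs (h - r))); split; [now apply Rmin_glb_lt|].
  intros r' [<- | I]; [apply Rmin_r|].
  apply Rle_trans with (2 := K r' I), Rmin_l.
Qed.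

(** * The theorem *)

(** [I0] is the infimum that defines the injectivity radius, before halving. It must be shown
    finite: distances are nonnegative, and the orbit has at least two points. *)
Lemma orbit_separation (Gam : C * C -> Prop) x rho :
  is_subgroup Gam -> inD x -> 0 < rho ->
  (forall N, su11 N -> exists g t, Gam g /\ hdist (kappa N t) (mob g x) < rho) ->
  Rbar_lt (Finite rho) (inj_rad Gam x) ->
  exists I0, 2 * rho < I0 /\
    (forall y z, orbit Gam x y -> orbit Gam x z -> y <> z -> I0 <= hdist y z) /\
    (forall eps, 0 < eps -> exists y z,
       orbit Gam x y /\ orbit Gam x z /\ y <> z /\ hdist y z < I0 + eps).
Proof.
  intros (Gsu & G1 & _ & _) Hx Hrho Hhit Hinj.
  unfold inj_rad in Hinj.
  set (E := fun r => exists y z, orbit Gam x y /\ orbit Gam x z /\ y <> z /\ r = hdist y z) in *.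
  assert (HE : is_glb_Rbar E (Glb_Rbar E)) by apply Glb_Rbar_correct.
  assert (HD : forall y, orbit Gam x y -> inD y)
    by (intros y (g & Hg & ->); apply mob_inD; auto).
  (* A geodesic at distance at least [rho] from [x] is approached within [rho] by some orbit point,
     which cannot be [x]. *)
  assert (Hne : exists r, E r).
  { destruct (far_geodesic x rho Hx Hrho) as (N & SN & FN).
    destruct (Hhit N SN) as (g & t & Hg & L).
    exists (hdist x (mob g x)), x, (mob g x); repeat split.
    - exists su_one; split; [easy | now rewrite mob_one].
    - now exists g.
    - intros E0; rewrite <- E0, hdist_sym in L; specialize (FN t); lra. }
  destruct (Glb_Rbar E) as [I0 | | ]; destruct HE as [LB GL].
  - exists I0; split; [|split].
    + simpl in Hinj; lra.
    + intros y z Oy Oz Hyz; apply (LB (hdist y z)); now exists y, z.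
    + intros eps He; apply NNPP; intros No.
      assert (B : is_lb_Rbar E (Finite (I0 + eps))).
      { intros r (y & z & Oy & Oz & Hyz & ->); simpl; apply Rnot_lt_le; intros L; apply No; now exists y, z. }
      specialize (GL _ B); simpl in GL; lra.
  - exfalso; destruct Hne as [r Hr]; apply (LB r Hr).
  - exfalso; apply (GL (Finite 0)); intros r (y & z & Oy & Oz & _ & ->); simpl; apply hdist_ge0; auto.
Qed.

(* Geodesics through [y] in a direction [w] with [slope z y w = beta] cut off a gap of length
   [artanh (beta / cosh d(y,z))]; density makes the given geodesic approach such a configuration. *)
Lemma gap_lengths_limit (Gam : C * C -> Prop) M x rho I0 delta y z beta :
  is_subgroup Gam -> su11 M -> dense_geodesic Gam M -> inD x ->
  (forall y z, orbit Gam x y -> orbit Gam x z -> y <> z -> I0 <= hdist y z) ->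
  orbit Gam x y -> orbit Gam x z -> y <> z ->
  0 < delta <= rho -> rho + hdist y z / 2 + 2 * delta <= I0 ->
  0 < beta -> beta ^ 2 <= chd z y ^ 2 - 1 -> chd z y ^ 2 - cosh delta ^ 2 < beta ^ 2 ->
  exists r : nat -> R,
    is_lim_seq r (ln ((chd z y + beta) / (chd z y - beta)) / 2) /\
    eventually (fun n => gap_lengths (Splus Gam M rho x) (r n)).
Proof.
  intros HGam HM Hdense Hx Hsep Oy Oz Hyz Hdelta HI Hb Hb1 Hb2.
  destruct HGam as (Gsu & _ & Gmul & Ginv).
  assert (HD : forall q, orbit Gam x q -> inD q)
    by (intros q (g & Hg & ->); apply mob_inD; auto).
  assert (Dy := HD y Oy); assert (Dz := HD z Oz).
  assert (CD := chd_ge1 z y Dz Dy).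
  destruct (slope_surjective z y beta Dz Dy (not_eq_sym Hyz) Hb1) as (w & STw & Sw).
  assert (Hseq : forall n : nat, exists gtu : (C * C) * R * C,
    let '(g, t, u) := gtu in Gam g /\ is_derive (fun s => mob g (kappa M s)) t u /\
      Cmod (Cminus (mob g (kappa M t)) y) < / (INR n + 1) /\
      Cmod (Cminus u w) < / (INR n + 1)).
  { intros n; destruct (Hdense y w STw (/ (INR n + 1))) as (g & t & u & K).
    - apply Rinv_0_lt_compat; generalize (pos_INR n); lra.
    - now exists (g, t, u). }
  set (sq := fun n => proj1_sig (constructive_indefinite_description _ (Hseq n))).
  assert (Hsq : forall n, let '(g, t, u) := sq n in Gam g /\ is_derive (fun s => mob g (kappa M s)) t u /\
      Cmod (Cminus (mob g (kappa M t)) y) < / (INR n + 1) /\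
      Cmod (Cminus u w) < / (INR n + 1))
    by (intros n; unfold sq; apply (proj2_sig (constructive_indefinite_description _ (Hseq n)))).
  clearbody sq.
  set (g := fun n => fst (fst (sq n))); set (t := fun n => snd (fst (sq n))); set (u := fun n => snd (sq n)).
  assert (Hg : forall n, Gam (g n)) by (intros n; generalize (Hsq n); unfold g; destruct (sq n) as [[]]; easy).
  assert (Hd : forall n, is_derive (fun s => mob (g n) (kappa M s)) (t n) (u n))
    by (intros n; generalize (Hsq n); unfold g, t, u; destruct (sq n) as [[]]; easy).
  set (p := fun n => mob (g n) (kappa M (t n))).
  destruct (is_lim_seq_Cminus_small p y) as [P1 P2];
    [intros n; generalize (Hsq n); unfold p, g, t; destruct (sq n) as [[]]; easy|].
  destruct (is_lim_seq_Cminus_small u w) as [U1 U2];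
    [intros n; generalize (Hsq n); unfold u; destruct (sq n) as [[]]; easy|].
  clear Hsq.
  (* Values and slopes of the distance functions tend to those of the geodesic through [y] in
     direction [w]: 1 and 0 for [y], [chd z y] and [beta] for [z]. *)
  assert (Ay := is_lim_seq_chd p y y Dy Dy P1 P2).
  assert (Az := is_lim_seq_chd p y z Dy Dz P1 P2).
  assert (By := is_lim_seq_slope p u y w y Dy Dy P1 P2 U1 U2).
  assert (Bz := is_lim_seq_slope p u y w z Dy Dz P1 P2 U1 U2).
  rewrite chd_diag in Ay; rewrite slope_diag in By; rewrite Sw in Bz.
  assert (Hbc : beta < chd z y) by nra.
  assert (Ty := is_lim_seq_half_ln _ _ _ _ Ay By ltac:(lra)).
  assert (Tz := is_lim_seq_half_ln _ _ _ _ Az Bz ltac:(lra)).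
  replace (ln ((1 + 0) / (1 - 0)) / 2) with 0 in Ty
    by (replace ((1 + 0) / (1 - 0)) with 1 by field; rewrite ln_1; field).
  (* The offset from [t n] to the parameter of the projection of [q], as in [foot_param]; in
     differences [t n] cancels. *)
  set (tau := fun q n => ln ((chd q (p n) + slope q (p n) (u n)) / (chd q (p n) - slope q (p n) (u n))) / 2).
  exists (fun n => tau z n - tau y n).
  set (lam := ln ((chd z y + beta) / (chd z y - beta)) / 2) in *.
  assert (Lr : is_lim_seq (fun n => tau z n - tau y n) lam).
  { replace lam with (lam - 0) by ring; now apply is_lim_seq_minus'. }
  split; [exact Lr|].
  assert (Hlam : 0 < lam).
  { unfold lam; apply Rdiv_lt_0_compat; [|lra].
    rewrite <- ln_1; apply ln_increasing; [lra|]; apply Rlt_div_r; lra. }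
  assert (Cdel : 1 < cosh delta) by (rewrite <- cosh_0; apply cosh_lt; lra).
  (* Here [a^2 - b^2] is the squared cosh of the distance to the geodesic. Its limit is 1 for [y]
     and [chd z y ^ 2 - beta ^ 2] for [z], both below [cosh delta ^ 2]. *)
  assert (Sq : forall a b : nat -> R, forall a0 b0 : R, is_lim_seq a a0 -> is_lim_seq b b0 ->
     a0 ^ 2 - b0 ^ 2 < cosh delta ^ 2 -> eventually (fun n => a n ^ 2 - b n ^ 2 < cosh delta ^ 2)).
  { intros a b a0 b0 Ha Hb0 L; apply is_lim_seq_eventually_lt with (2 := L).
    simpl; apply is_lim_seq_minus'; repeat apply is_lim_seq_mult'; auto; apply is_lim_seq_const. }
  assert (E1 := Sq _ _ _ _ Ay By ltac:(nra)).
  assert (E2 := Sq _ _ _ _ Az Bz ltac:(lra)).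
  assert (E3 : eventually (fun n => 0 < tau z n - tau y n)).
  { assert (L : is_lim_seq (fun n => - (tau z n - tau y n)) (- lam)) by now apply (is_lim_seq_opp _ lam).
    assert (K := is_lim_seq_eventually_lt _ _ 0 L ltac:(lra)); revert K; apply filter_imp; intros; lra. }
  generalize (filter_and _ _ E1 (filter_and _ _ E2 E3)); apply filter_imp.
  intros n (F1 & F2 & F3).
  assert (Sg := Gsu _ (Hg n)); assert (Sgi := su11_inv _ Sg).
  destruct (foot_param (g n) M (t n) (u n) y Sg HM Dy (Hd n)) as (ry & Ry & Qy & Ky).
  destruct (foot_param (g n) M (t n) (u n) z Sg HM Dz (Hd n)) as (rz & Rz & Qz & Kz).
  fold (p n) in Qy, Qz, Ky, Kz; fold (tau y n) in Ky; fold (tau z n) in Kz.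
  replace (tau z n - tau y n) with ((t n + tau z n) - (t n + tau y n)) by ring.
  assert (Om : forall q, orbit Gam x q -> orbit Gam x (mob (su_inv (g n)) q)).
  { intros q (h & Hh & ->); exists (su_mul (su_inv (g n)) h); split; [apply Gmul; auto|].
    symmetry; apply mob_mul; auto. }
  apply (gap_criterion Gam M x rho I0 delta (mob (su_inv (g n)) y) (mob (su_inv (g n)) z) ry rz); auto.
  - nra.
  - nra.
  - now rewrite hdist_mob.
  - lra.
Qed.

Theorem theorem3p7
  (Gam : C * C -> Prop) (n : nat) (v : nat -> C) (M : C * C) (x : C) (rho : R) :
  is_Fuchsian Gam ->
  polygon_ok n v ->
  is_fundamental_domain Gam n v ->
  side_pairings_not_involutions Gam n v ->
  su11 M ->
  dense_geodesic Gam M ->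
  polygon_int n v x ->
  0 < rho ->
  (forall N : C * C, su11 N ->
     exists g t, Gam g /\ hdist (kappa N t) (mob g x) < rho) ->
  Rbar_lt (Finite rho) (inj_rad Gam x) ->
  countably_infinite (gap_lengths (Splus Gam M rho x)).
Proof.
  intros [HGam _] _ _ _ HM Hdense [Hx _] Hrho Hhit Hinj.
  destruct (gap_code (Splus Gam M rho x)) as [c Hc].
  (* It remains to find a gap length outside an arbitrary finite list. *)
  apply (countably_infinite_of_code _ c Hc); intros l.
  destruct (orbit_separation Gam x rho HGam Hx Hrho Hhit Hinj) as (I0 & HI & Hsep & Hmin).
  (* The excess of [hdist y z] over [I0] costs at most half of the margin [I0 / 2 - rho], and
     [2 delta] at most the other half. Together they give
     [rho + hdist y z / 2 + 2 * delta <= I0]. *)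
  destruct (Hmin (I0 / 2 - rho) ltac:(lra)) as (y & z & Oy & Oz & Hyz & HD).
  set (delta := Rmin rho ((I0 / 2 - rho) / 4)).
  assert (Hd : 0 < delta <= rho) by (split; [apply Rmin_glb_lt; lra | apply Rmin_l]).
  assert (Hd' : delta <= (I0 / 2 - rho) / 4) by apply Rmin_r.
  destruct HGam as (Gsu & HG').
  assert (Dy : inD y) by (destruct Oy as (g & Hg & ->); apply mob_inD; auto).
  assert (Dz : inD z) by (destruct Oz as (g & Hg & ->); apply mob_inD; auto).
  assert (C1 : 1 < chd z y).
  { rewrite <- cosh_hdist, <- cosh_0 by easy; apply cosh_lt; [lra|].
    assert (S := Hsep z y Oz Oy (not_eq_sym Hyz)); lra. }
  assert (Cdel : 1 < cosh delta) by (rewrite <- cosh_0; apply cosh_lt; lra).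
  set (cc := chd z y) in *.
  (* The squares [beta^2] between [m] and [cc^2 - 1] are admissible; this range is nonempty because
     [cosh delta > 1]. *)
  set (m := Rmax 0 (cc ^ 2 - cosh delta ^ 2)).
  assert (Hm : m < cc ^ 2 - 1) by (apply Rmax_lub_lt; nra).
  assert (Hm0 : 0 <= m) by apply Rmax_l.
  assert (Hm1 : cc ^ 2 - cosh delta ^ 2 <= m) by apply Rmax_r.
  (* The limit length [lam] will satisfy [beta = cc * tanh lam], so avoiding these values keeps
     [lam] out of [l]. *)
  destruct (interval_avoid_list (map (fun r => cc * tanh r) l) (sqrt m) (sqrt (cc ^ 2 - 1)))
    as (beta & Hb & Nb); [now apply sqrt_lt_1_alt|].
  assert (B0 := sqrt_pos m).
  assert (B1 : m < beta ^ 2) by (rewrite <- (pow2_sqrt m) by easy; nra).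
  assert (B2 : beta ^ 2 < cc ^ 2 - 1) by (rewrite <- (pow2_sqrt (cc ^ 2 - 1)) by lra; nra).
  destruct (gap_lengths_limit Gam M x rho I0 delta y z beta) as (r & Lr & Er); auto; fold cc; try lra.
  { now split. }
  fold cc in Lr.
  set (lam := ln ((cc + beta) / (cc - beta)) / 2) in *.
  assert (Nl : ~ In lam l).
  { intros I; apply Nb, in_map_iff; exists lam; split; [|easy].
    assert (Pq : 0 < (cc + beta) / (cc - beta)) by (apply Rdiv_lt_0_compat; nra).
    assert (E : exp lam * exp lam = (cc + beta) / (cc - beta)).
    { rewrite <- exp_plus; unfold lam; rewrite <- (exp_ln ((cc + beta) / (cc - beta))) at 3 by easy.
      f_equal; field. }
    assert (P := exp_pos lam).
    replace (tanh lam) with ((exp lam * exp lam - 1) / (exp lam * exp lam + 1)).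
    - rewrite E; field; nra.
    - unfold tanh, sinh, cosh; rewrite exp_Ropp; field; repeat split; nra. }
  (* A gap length closer than [e] to [lam] cannot belong to [l]. *)
  destruct (list_separated l lam Nl) as (e & He & Se).
  apply is_lim_seq_spec in Lr; specialize (Lr (mkposreal e He)).
  destruct (filter_and _ _ Er Lr) as [N HN]; destruct (HN N (Nat.le_refl N)) as [GN LN].
  exists (r N); split; [easy|]; intros I; specialize (Se _ I); simpl in LN; lra.
Qed.
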